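(* There exists a constant $\beta>0$ such that for every connected $P_7$-free graph $G$ on at least two vertices, for every potential maximal clique $\Omega$ of $G$, and for every probability measure $\mu$ on $\Omega$, there exists a vertex $v\in V(G)$ with $\mu(N(v))\ge\beta$.
   Context: All graphs are finite, simple and undirected. $P_k$ denotes the path on $k$ vertices; $G$ is $P_k$-free if it has no induced subgraph isomorphic to $P_k$. $N(v)$ is the open neighbourhood of $v$, and $\mu(N(v))$ means $\mu(N(v)\cap\Omega)$. A graph is chordal if every induced cycle has length three. A triangulation of $G$ is a set $F$ of non-edges of $G$ such that $(V(G),E(G)\cup F)$ is chordal; it is minimal if no proper subset of $F$ is a triangulation. A potential maximal clique of $G$ is a set $\Omega\subseteq V(G)$ that is a maximal clique in $(V(G),E(G)\cup F)$ for some minimal triangulation $F$ of $G$. *)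

(* Defs.v *)
From HB Require Import structures.
From mathcomp Require Import all_boot all_order all_algebra.
From mathcomp Require Import Rstruct.
From Stdlib Require Import Rdefinitions.
Set Implicit Arguments. Unset Strict Implicit. Unset Printing Implicit Defensive.
Import Order.TTheory GRing.Theory Num.Theory.

Definition simple_graph (T : finType) (E : rel T) : Prop :=
  symmetric E /\ irreflexive E.

Definition connected_graph (T : finType) (E : rel T) : Prop :=
  forall x y : T, connect E x y.

Definition has_induced_path (T : finType) (E : rel T) (k : nat) : Prop :=
  exists f : 'I_k -> T, injective f /\
    forall i j : 'I_k, E (f i) (f j) = ((i.+1 == j :> nat) || (j.+1 == i :> nat)).

Definition Pk_free (T : finType) (E : rel T) (k : nat) : Prop :=
  ~ has_induced_path E k.

Definition has_induced_cycle (T : finType) (E : rel T) (k : nat) : Prop :=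
  3 <= k /\ exists f : 'I_k -> T, injective f /\
    forall i j : 'I_k, E (f i) (f j) =
      ((i.+1 %% k == j :> nat) || (j.+1 %% k == i :> nat)).

Definition chordal (T : finType) (E : rel T) : Prop :=
  forall k, has_induced_cycle E k -> k = 3.

Definition fill (T : finType) (E : rel T) (F : {set {set T}}) : rel T :=
  fun x y => (x != y) && (E x y || ([set x; y] \in F)).

Definition nonedge_set (T : finType) (E : rel T) (F : {set {set T}}) : Prop :=
  forall e, e \in F -> exists x y, x != y /\ ~~ E x y /\ e = [set x; y].

Definition triangulation (T : finType) (E : rel T) (F : {set {set T}}) : Prop :=
  nonedge_set E F /\ chordal (fill E F).

Definition minimal_triangulation (T : finType) (E : rel T) (F : {set {set T}})
  : Prop :=
  triangulation E F /\ forall F' : {set {set T}}, F' \proper F -> ~ triangulation E F'.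

Definition is_clique (T : finType) (E : rel T) (K : {set T}) : Prop :=
  forall x y, x \in K -> y \in K -> x != y -> E x y.

Definition maximal_clique (T : finType) (E : rel T) (K : {set T}) : Prop :=
  is_clique E K /\ forall K' : {set T}, K \proper K' -> ~ is_clique E K'.

Definition potential_maximal_clique (T : finType) (E : rel T) (Om : {set T})
  : Prop :=
  exists F, minimal_triangulation E F /\ maximal_clique (fill E F) Om.

Local Open Scope ring_scope.

Definition prob_on (T : finType) (Om : {set T}) (mu : T -> R) : Prop :=
  (forall x, x \in Om -> (0 <= mu x)%R) /\ (\sum_(x in Om) mu x = 1)%R.

Definition mu_nbhd (T : finType) (E : rel T) (Om : {set T}) (mu : T -> R) (v : T)
  : R := (\sum_(x in Om | E v x) mu x)%R.

(* Main.v *)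
(* Suppose that every neighbourhood has measure less than a small beta.

   Separators.  Let D be a component of G - Omega and S = N(D).  Since Omega is
   not contained in N(D), S also lies in the neighbourhood of a component B of
   G - S other than D.  As G is P_7-free, no vertex of S starts an induced P_4
   into D and another one into B.  If v starts no induced P_4 into D, then the
   component C_v of a fixed p in D - N(v) is a module of D.  A vertex z attached
   to C_v is adjacent to all of C_v, so the u with C_u included in C_v are
   adjacent to z and have measure at most beta.  Hence, for most pairs u, v, the
   sets C_u and C_v are incomparable, which gives an induced path u w z v
   through D.  Joining it at v either to an induced P_4 into B, or to a path
   v z' w' u' obtained in the same way in B, yields an induced P_7; so S has
   measure at most 24 beta.

   Conclusion.  Nonadjacent u, v in Omega lie in N(D(u,v)) for some component
   D(u,v).  For random u1, ..., u4 in Omega, with positive probability they are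
   pairwise nonadjacent and no N(D(ui,ui+1)) contains one of the other two
   points; then u1 D(u1,u2) u2 D(u2,u3) u3 D(u3,u4) u4 contains an induced path
   on at least 7 vertices. *)

Require Import Defs.
From mathcomp Require Import all_boot all_order all_algebra.
From mathcomp Require Import Rstruct zify ring lra.
From Stdlib Require Import Rdefinitions.
Import Order.TTheory GRing.Theory Num.Theory.
Set Implicit Arguments. Unset Strict Implicit. Unset Printing Implicit Defensive.

(** * Induced paths and holes *)

Section InducedPaths.
Variables (T : finType) (E : rel T).
Hypotheses (symE : symmetric E) (irrE : irreflexive E).
Implicit Types (U A W : {set T}) (x y z : T) (s p : seq T).

Definition within U : rel T := [rel a b | [&& a \in U, b \in U & E a b]].
(** [connect] is reflexive, so [linked U x x] holds for every [x], even outside [U]. *)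
Definition linked U x y := connect (within U) x y.

Lemma linked_sym U : symmetric (linked U).
Proof.
apply: sym_connect_sym => a b.
by rewrite /within /= symE; case: (a \in U); case: (b \in U).
Qed.

Lemma linked1 U x y : x \in U -> y \in U -> E x y -> linked U x y.
Proof. by move=> xU yU xy; apply: connect1; rewrite /within /= xU yU. Qed.

Lemma linked_ind U x (P : T -> Prop) :
    P x -> (forall a b, a \in U -> b \in U -> E a b -> P a -> P b) ->
  forall y, linked U x y -> P y.
Proof.
move=> Px step y /connectP[p + ->]; elim: p x Px => //= a p IH x Px.
by case/andP=> /and3P[xU aU xa]; apply: IH; apply: step xa Px.
Qed.

Lemma linked_mem U x y : linked U x y -> x \in U -> y \in U.
Proof. by move=> xy xU; move: y xy; apply: linked_ind. Qed.

Lemma linked_subset U W x y : U \subset W -> linked U x y -> linked W x y.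
Proof.
move=> /subsetP UW; move: y; apply: linked_ind; first exact: connect0.
by move=> a b /UW aW /UW bW ab xa; apply: connect_trans xa (linked1 aW bW ab).
Qed.

Lemma linked_crossing U (P : pred T) x y :
    linked U x y -> P x -> ~~ P y ->
  exists a b, [/\ a \in U, b \in U, E a b, P a & ~~ P b].
Proof.
move=> xy Px nPy.
suff: P y \/ exists a b, [/\ a \in U, b \in U, E a b, P a & ~~ P b].
  by case=> // Py; rewrite Py in nPy.
move: y xy {nPy}; apply: linked_ind; first by left.
move=> a b aU bU ab [Pa|]; last by right.
by case: (boolP (P b)) => [|nPb]; [left | right; exists a, b].
Qed.

(** A walk is cut at its first vertex satisfying [P]. When [P] is adjacency to a vertex [w], the
    part kept avoids the neighbours of [w] except at its end, as the link of a hole at [w] must. *)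
Lemma linked_first_hit U (P : pred T) x y :
    linked U x y -> ~~ P x -> P y ->
  exists c, [/\ c \in U, P c &
    linked (c |: [set a in U | ~~ P a]) x c].
Proof.
case/connectP=> p + ->; elim: p x => [|a p IH] x /= => [_ /negP //|].
case/andP=> /and3P[xU aU xa] pth nPx Py.
case: (boolP (P a)) => Pa.
  exists a; split=> //; apply: linked1 => //; rewrite !inE ?eqxx //.
  by rewrite xU nPx orbT.
have [c [cU Pc ac]] := IH a pth Pa Py.
exists c; split=> //; apply: connect_trans ac; apply: linked1 => //.
  by rewrite !inE xU nPx orbT.
by rewrite !inE aU Pa orbT.
Qed.

Lemma linked_subrel (E' : rel T) U x y :
    (forall a b, a \in U -> b \in U -> E a b -> E' a b) ->
  linked U x y -> connect [rel a b | [&& a \in U, b \in U & E' a b]] x y.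
Proof.
move=> sub; move: y; apply: linked_ind; first exact: connect0.
move=> a b aU bU ab xa; apply: connect_trans xa (connect1 _).
by rewrite /= aU bU sub.
Qed.

(* [s] is an induced path, up to repetitions: distinctness is not required, but
   follows from the adjacencies as soon as [s] has at least four vertices. *)
Fixpoint ipath s : bool :=
  if s is x :: s' then
    (if s' is y :: s'' then E x y && all (fun w => ~~ E x w) s'' else true)
    && ipath s'
  else true.

Lemma ipath_consE x y s :
  ipath (x :: y :: s) = [&& E x y, all (fun w => ~~ E x w) s & ipath (y :: s)].
Proof. by rewrite /= -andbA. Qed.

Lemma ipath_suffix s1 s2 : ipath (s1 ++ s2) -> ipath s2.
Proof. by elim: s1 => //= x s1 IH /andP[_ /IH]. Qed.

Lemma ipath_adj x0 s i j : ipath s -> i < size s -> j < size s ->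
  E (nth x0 s i) (nth x0 s j) = ((i.+1 == j) || (j.+1 == i)).
Proof.
wlog lt_ij : i j / i <= j => [hw|].
  case: (leqP i j) => [|/ltnW] lt hs hi hj; first exact: hw.
  by rewrite symE hw // orbC.
elim: s i j lt_ij => // x s IH [|i] [|j] // lt_ij.
- case: s IH => [|y s] IH; first by move=> _ _ /=; rewrite ltnS ltn0.
  rewrite ipath_consE => /and3P[xy /all_nthP nx _] _.
  case: j lt_ij => [|j] _ /=; first by rewrite xy.
  by rewrite !ltnS => /(nx x0) /negbTE ->.
by move=> hs; rewrite /= !ltnS !eqSS; apply: IH => //; case/andP: hs.
Qed.

Lemma ipath_cat s1 v s2 :
    ipath (rcons s1 v) -> ipath (v :: s2) ->
    {in s1 & s2, forall a b, ~~ E a b} ->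
  ipath (s1 ++ v :: s2).
Proof.
elim: s1 => // x [|y s1] IH.
  rewrite ipath_consE => /and3P[xv _ _] hv nE; rewrite ipath_consE xv hv andbT.
  by apply/allP=> b bs; apply: nE => //; rewrite mem_head.
rewrite rcons_cons [rcons _ _]/= ipath_consE all_rcons => /and3P[xy /andP[xv xs] h1] h2 nE.
rewrite [_ ++ _]/= ipath_consE xy all_cat xs /= xv.
rewrite (_ : all _ s2) /=; last first.
  by apply/allP=> b bs; apply: nE => //; rewrite mem_head.
by apply: IH => // a b a1 b2; apply: nE => //; rewrite inE a1 orbT.
Qed.

Lemma last_occurrence (P : pred T) s : has P s ->
  exists s1 c s2, [/\ s = s1 ++ c :: s2, P c & all (fun w => ~~ P w) s2].
Proof.
elim: s => //= x s IH; case: (boolP (has P s)) => [/IH|nP].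
  by case=> s1 [c [s2 [-> Pc Ps2]]] _; exists (x :: s1), c, s2.
by rewrite orbF => Px; exists [::], x, s; split=> //; rewrite all_predC.
Qed.

(** Induction along a walk: the induced path found from the second vertex [a] is entered at its last
    vertex that equals [x] or is adjacent to [x], which removes chords at [x] and returns to [x]. *)
Lemma linked_ipath U x y : linked U x y ->
  exists s, [/\ ipath (x :: s), last x s = y, uniq (x :: s) & {subset s <= U}].
Proof.
case/connectP=> p + ->; elim: p x => [|a p IH] x /=; first by exists [::].
case/andP=> /and3P[xU aU xa] /IH[s [ip <- us sU]].
have [] := @last_occurrence (fun c => (c == x) || E x c) (a :: s).
  by rewrite /= xa orbT.
move=> s1 [c [s2 [eas Pc /allP s2P]]].
have lst : last a s = last c s2.
  have -> : last a s = last x (a :: s) by [].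
  by rewrite eas last_cat.
move: ip us; rewrite eas => /ipath_suffix ip; rewrite cat_uniq => /and3P[_ _ us].
have cs2U : {subset c :: s2 <= U}.
  move=> w ws; have: w \in a :: s by rewrite eas mem_cat ws orbT.
  by rewrite inE => /predU1P[-> //|/sU].
have [ecx|ncx] := eqVneq c x.
  exists s2; rewrite -ecx; split=> // w ws; apply: cs2U; by rewrite inE ws orbT.
rewrite (negbTE ncx) /= in Pc.
exists (c :: s2); split=> //.
  rewrite Pc ip andbT /=; apply/allP=> w /s2P.
  by rewrite negb_or => /andP[].
rewrite us andbT inE negb_or eq_sym ncx /=.
by apply/negP=> /s2P; rewrite eqxx.
Qed.

(** For injectivity, two positions carrying the same vertex have the same adjacencies along the
    path. They are told apart by the successor of the larger one, by the predecessor of the smaller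
    one, or, if they are the two ends, by position 1; this last case uses [3 < k]. *)
Lemma ipath_has_induced_path k s : 3 < k -> ipath s -> k <= size s ->
  has_induced_path E k.
Proof.
move=> k3 ips ks; case: s ips ks => [|x0 s] ips ks; first by move: (leq_trans k3 ks).
set s' := x0 :: s in ips ks *.
have lt (i : 'I_k) : i < size s' by apply: leq_trans ks.
exists (fun i => nth x0 s' i); split; last by move=> i j; rewrite ipath_adj.
have inj (i j : 'I_k) : i < j -> nth x0 s' i != nth x0 s' j.
  move=> ij; apply/eqP=> e.
  have row (l : nat) : l < k ->
      ((i.+1 == l) || (l.+1 == i)) = ((j.+1 == l) || (l.+1 == j)).
    by move=> lk; rewrite -!(ipath_adj x0 ips) ?e // (leq_trans lk ks).
  have jk := ltn_ord j.
  case: (ltnP j.+1 k) => h; first by have := row _ h; lia.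
  case: (posnP i) => i0; first by have := row 1; lia.
  by have := row i.-1; lia.
move=> i j e; case: (ltngtP i j) => [/inj|/inj|/val_inj //]; by rewrite e eqxx.
Qed.

(* An induced cycle of length at least four through [y], [x], [z], with the
   path from [y] to [z] weakened to mere connectivity outside the closed
   neighbourhood of [x]. *)
Definition hole x y z : Prop :=
  [/\ E x y, E x z, y != z, ~~ E y z &
    linked ([set y; z] :|: [set w | (w != x) && ~~ E x w]) y z].

Lemma hole_sym x y z : hole x y z -> hole x z y.
Proof.
case=> xy xz yz nyz l; split=> //; rewrite 1?eq_sym 1?symE //.
by rewrite linked_sym setUC [[set z; y]]setUC setUC.
Qed.

(** Once the link is shortened to an induced path [t], only the two ends of [t] are adjacent to [x],
    so [x :: t] is an induced cycle. As [y] and [z] are distinct and nonadjacent, [t] has at least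
    three vertices. *)
Lemma hole_induced_cycle x y z : hole x y z ->
  exists2 k, 3 < k & has_induced_cycle E k.
Proof.
case=> xy xz yz nyz /linked_ipath[s [ips lst us sU]].
have [t te] : {t | t = y :: s} by exists (y :: s).
have [k ke] : {k | k = (size t).+1} by exists (size t).+1.
have st : size t = (size s).+1 by rewrite te.
rewrite -te in ips us.
have y0 : nth x t 0 = y by rewrite te.
have nth_last : nth x t (size s) = z by rewrite te -lst (last_nth x).
have s2 : 2 <= size s.
  case: s lst te {nth_last st sU} => [|a [|b s]] //=; first by move/eqP; rewrite (negbTE yz).
  by move=> -> te; move: ips; rewrite te /= (negbTE nyz).
have xt w : w \in t -> E x w = (w == y) || (w == z).
  move=> wt; have [->|wy] := eqVneq w y; first by rewrite xy.
  have [->|wz] := eqVneq w z; first by rewrite xz.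
  move: wt; rewrite te inE (negbTE wy) => /sU.
  by rewrite !inE (negbTE wy) (negbTE wz) /= => /andP[_ /negbTE].
have xnt : x \notin t.
  have nxy : x != y by apply: contraL xy => /eqP ->; rewrite irrE.
  have nxz : x != z by apply: contraL xz => /eqP ->; rewrite irrE.
  rewrite te inE negb_or nxy /=; apply: contra nxz => /sU.
  by rewrite !inE eqxx (negbTE nxy) orbF.
exists k; first by lia.
split; first by lia.
exists (fun i : 'I_k => nth x (x :: t) i); split.
  move=> [i hi] [j hj] /= /eqP; rewrite nth_uniq ?cons_uniq ?xnt ?us /= -?ke //.
  by move/eqP=> e; apply: val_inj.
have xn j : j < size t -> E x (nth x t j) = (j == 0) || (j == size s).
  move=> jt; rewrite xt ?mem_nth //.
  by rewrite -nth_last -[in _ == y]y0 !nth_uniq // st.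
have mod1 : 1 %% k = 1 by rewrite modn_small //; lia.
(* Position [a] of [t] has index [a.+1] on the cycle, [x] having index 0; the next index wraps
   around exactly when [a] is the last position. *)
have modS a : a < size t -> a.+2 %% k = if a == size s then 0 else a.+2.
  move=> ha; case: eqVneq => [->|ne]; first by rewrite ke st modnn.
  by rewrite modn_small //; lia.
move=> [[|i] hi] [[|j] hj]; rewrite /=.
- by rewrite irrE mod1.
- by rewrite xn ?mod1 ?modS //; [case: ifP; lia | lia | lia].
- by rewrite symE xn ?mod1 ?modS //; [case: ifP; lia | lia | lia].
rewrite ipath_adj // ?modS //; try lia.
by case: ifP; case: ifP; lia.
Qed.

(** The hole is centred at vertex 0, between vertices 1 and [k.-1]; the rest of the cycle is the
    link. *)
Lemma induced_cycle_hole k : 3 < k -> has_induced_cycle E k ->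
  exists x y z, hole x y z.
Proof.
move=> k3 [_ [f [injf adj]]].
have k1 : 1 < k by lia. have k0 : 0 < k by lia. have kl : k.-1 < k by lia.
pose o0 := Ordinal k0; pose o1 := Ordinal k1; pose ol := Ordinal kl.
have e1 : 1 %% k = 1 by rewrite modn_small.
have e2 : 2 %% k = 2 by rewrite modn_small //; lia.
have el : k.-1.+1 %% k = 0 by rewrite prednK // modnn.
have fE (i j : 'I_k) : (f i == f j) = (i == j :> nat).
  by rewrite (inj_eq injf).
exists (f o0), (f o1), (f ol); split.
- by rewrite adj /= e1 eqxx.
- by rewrite adj /= el orbC.
- by rewrite fE /=; lia.
- by rewrite adj /= e2 el; lia.
set U := (X in linked X).
have inU (i : 'I_k) : 0 < i -> f i \in U.
  move=> i0; rewrite !inE !fE adj /= e1.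
  have ik := ltn_ord i.
  have [eil|nil] := eqVneq (i : nat) k.-1; first by rewrite orbT.
  by rewrite modn_small; lia.
suff st (n : nat) (hn : n.+1 < k) : linked U (f o1) (f (Ordinal hn)).
  have hn : k.-2.+1 < k by lia.
  have -> : ol = Ordinal hn by apply: val_inj => /=; lia.
  exact: st.
elim: n hn => [|n IH] hn.
  have -> : Ordinal hn = o1 by apply: val_inj.
  exact: connect0.
have hn' : n.+1 < k by lia.
apply: connect_trans (IH hn') _; apply: linked1; rewrite ?inU //.
by rewrite adj /= modn_small // eqxx.
Qed.

Lemma chordalP : chordal E <-> forall x y z, ~ hole x y z.
Proof.
split=> [ch x y z /hole_induced_cycle[k k3 /ch k_eq]|nh k ck].
  by rewrite k_eq in k3.
have [k3 _] := ck; move: k3; rewrite leq_eqVlt => /predU1P[//|k3].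
by case: (induced_cycle_hole k3 ck) => x [y [z /nh]].
Qed.

End InducedPaths.

(** * Potential maximal cliques *)

(* [g a] is the set of vertices of [W] attached to the part of the complement
   of [W] that contains [a]; as it is a clique, a detour through this part can
   be shortened. *)
Lemma linked_shortcut (T : finType) (K : rel T) (U W : {set T})
    (g : T -> {set T}) (y z : T) :
    symmetric K ->
    (forall a b, K a b -> a \notin W -> b \notin W -> g a = g b) ->
    (forall a b, K a b -> a \in W -> b \notin W -> a \in g b) ->
    (forall a, a \notin W -> is_clique K (g a)) ->
    y \in W -> z \in W -> linked K U y z -> linked K (U :&: W) y z.
Proof.
move=> symK gW gb gK yW zW yz.
(* Invariant along the walk: outside [W], some attachment vertex [s] of the current part has already
   been reached, and [s] is adjacent or equal to whichever attachment vertex the walk leaves by. *)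
pose P a := if a \in W then linked K (U :&: W) y a : Prop
  else exists s, [/\ s \in U :&: W, s \in g a & linked K (U :&: W) y s].
suff: P z by rewrite /P zW.
move: z yz {zW}; apply: linked_ind; first by rewrite /P yW; apply: connect0.
move=> a b aU bU ab; rewrite /P.
case: (boolP (a \in W)) => aW; case: (boolP (b \in W)) => bW.
- move=> ya; apply: connect_trans ya (linked1 _ _ ab); rewrite inE ?aU ?bU //.
- by move=> ya; exists a; rewrite inE aU aW (gb a b).
- case=> s [sUW sg ys]; have bg : b \in g a by apply: gb => //; rewrite symK.
  have [<- //|sb] := eqVneq s b.
  apply: connect_trans ys (linked1 sUW _ (gK a aW _ _ sg bg sb)).
  by rewrite inE bU bW.
- by rewrite (gW a b).
Qed.

(** * Components outside a potential maximal clique and their boundaries *)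

Section Components.
Variables (T : finType) (E : rel T).
Hypotheses (symE : symmetric E) (irrE : irreflexive E).
Variable Om : {set T}.
Implicit Types (a b d u v x y z : T) (F : {set {set T}}).

(** This is a component of the complement of [Om] only for [d] outside [Om]; for [d] in [Om] it
    reduces to [d] alone. *)
Definition comp d := [set x | linked E (~: Om) d x].
Definition bd d := [set s in Om | [exists x in comp d, E x s]].

Lemma comp_refl d : d \in comp d.
Proof. by rewrite inE; apply: connect0. Qed.

Lemma comp_notin d x : d \notin Om -> x \in comp d -> x \notin Om.
Proof. by move=> dO; rewrite inE => /linked_mem; rewrite !inE; apply. Qed.

Lemma comp_eq d x : x \in comp d -> comp x = comp d.
Proof.
rewrite inE => dx; apply/setP=> w; rewrite !inE.
by apply/idP/idP; apply: connect_trans; rewrite // -/(linked E _ _ _) linked_sym.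
Qed.

Lemma bd_eq d x : x \in comp d -> bd x = bd d.
Proof. by move=> /comp_eq e; rewrite /bd e. Qed.

Lemma bd_sub d : bd d \subset Om.
Proof. by apply/subsetP=> x; rewrite inE => /andP[]. Qed.

Lemma bdP d s : reflect (s \in Om /\ exists2 x, x \in comp d & E x s) (s \in bd d).
Proof.
rewrite inE; apply: (iffP andP) => [[sO /existsP[x /andP[xd xs]]]|[sO [x xd xs]]].
  by split=> //; exists x.
by split=> //; apply/existsP; exists x; rewrite xd.
Qed.

Lemma comp_step d a b : d \notin Om -> a \in comp d -> E a b ->
  b \in comp d :|: bd d.
Proof.
move=> dO ad ab; rewrite in_setU; case: (boolP (b \in Om)) => bO.
  by apply/orP; right; apply/bdP; split=> //; exists a.
rewrite -(comp_eq ad) inE linked1 // inE //; exact: comp_notin ad.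
Qed.

Lemma comp_linked d x y : d \notin Om -> x \in comp d -> y \in comp d ->
  linked E (comp d) x y.
Proof.
move=> dO xd yd; have: linked E (~: Om) x y by rewrite -(comp_eq xd) inE in yd.
move: (y); clear y yd => y xy.
suff: y \in comp d /\ linked E (comp d) x y by case.
move: y xy; apply: linked_ind; first by split=> //; apply: connect0.
move=> a b aO bO ab [ad xa].
have bd : b \in comp d by rewrite -(comp_eq ad) inE linked1.
by split=> //; apply: connect_trans xa (linked1 ad bd ab).
Qed.

(* Cells [comp d :|: bd d] in which [K] agrees with the chordal [H] are glued
   along cliques to [Om], which misses at most the edge [u v]. *)
Lemma glue_no_hole (H K : rel T) u v :
    symmetric K -> irreflexive K ->
    (forall x y z, ~ hole H x y z) -> is_clique H Om ->
    (forall d, d \notin Om ->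
       {in comp d :|: bd d &, forall a b, K a b = H a b}) ->
    (forall d a b, d \notin Om -> a \in comp d -> K a b ->
       b \in comp d :|: bd d) ->
    {in Om &, forall a b, a != b -> [set a; b] != [set u; v] -> K a b} ->
    ~~ K u v ->
  forall x y z, ~ hole K x y z.
Proof.
move=> symK irrK nH clO KH Kstep KOm nuv.
have clB d : d \notin Om -> is_clique K (bd d).
  move=> dO a b abd bbd ab; rewrite (KH d) ?in_setU ?abd ?bbd ?orbT //.
  by apply: clO; rewrite ?(subsetP (bd_sub d)).
have gate d a b : d \notin Om -> K a b -> a \notin comp d :|: bd d ->
    b \in comp d :|: bd d -> b \in bd d.
  move=> dO ab aL; rewrite in_setU; case/orP => // bd.
  by rewrite (Kstep d b a) // symK in aL.
(* A hole of [K] with its three named vertices in one cell becomes a hole of [H]: shortcuts across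
   the clique [bd d] keep the link in the cell, where [K] and [H] agree. *)
have inside d x y z : d \notin Om -> x \in comp d :|: bd d ->
    y \in comp d :|: bd d -> z \in comp d :|: bd d -> ~ hole K x y z.
  move=> dO xL yL zL [xy xz yz nyz l]; apply: (nH x y z); split=> //.
  - by rewrite -(KH d).
  - by rewrite -(KH d).
  - by rewrite -(KH d).
  set U := (X in linked K X) in l.
  have {}l : linked K (U :&: (comp d :|: bd d)) y z.
    apply: (@linked_shortcut _ _ _ _ (fun=> bd d)) => // [a b ab aL bL|a _].
      by apply: gate bL aL; rewrite 1?symK.
    exact: clB.
  have {}l : linked H (U :&: (comp d :|: bd d)) y z.
    apply: (linked_subrel _ l) => a b; rewrite !in_setI => /andP[_ aL] /andP[_ bL].
    by rewrite (KH d).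
  apply: linked_subset l; apply/subsetP=> w; rewrite in_setI => /andP[wU wL].
  case/setUP: wU => wU; apply/setUP; [by left | right].
  by move: wU; rewrite !in_set (KH d).
(* If [y] were outside [Om], either [z] is in the cell of [y], or the link leaves [comp y] through
   some [b] in [bd y]. Then [x] and [b] lie in the clique [bd y], although [b] is nonadjacent to
   [x]. *)
have half x y z : hole K x y z -> x \in Om -> y \in Om.
  move=> h xO; case: (h) => xy xz yz nyz l.
  apply/negPn/negP=> yO; have yy := comp_refl y.
  have xL : x \in comp y :|: bd y by apply: (Kstep y y x) => //; rewrite symK.
  have xB : x \in bd y.
    by move: xL; rewrite in_setU => /orP[/comp_notin|//]; rewrite xO => /(_ yO).
  have yL : y \in comp y :|: bd y by rewrite in_setU yy.
  case: (boolP (z \in comp y :|: bd y)) => [zL|zL]; first exact: (inside y) h.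
  have nz : z \notin comp y by apply: contra zL; rewrite in_setU => ->.
  have [a [b [_ bU ab ay nb]]] := linked_crossing (P := mem (comp y)) l yy nz.
  have bB : b \in bd y.
    by have:= Kstep y a b yO ay ab; rewrite in_setU (negbTE nb : b \in _ = _).
  have bz : b != z by apply: contra zL => /eqP <-; rewrite in_setU bB orbT.
  have by_ : b != y by apply: contra nb => /eqP ->.
  move: bU; rewrite !inE (negbTE bz) (negbTE by_) /= => /andP[bx].
  by rewrite (clB y yO x b) // eq_sym.
move=> x y z h; case: (h) => xy xz yz nyz l.
case: (boolP (x \in Om)) => xO; last first.
  have xx := comp_refl x.
  apply: (inside x x y z) => //; first by rewrite in_setU xx.
    exact: (Kstep x x y).
  exact: (Kstep x x z).
have yO := half _ _ _ h xO.
have zO := half _ _ _ (hole_sym symK h) xO.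
(* All three vertices are now in [Om], so [y z] is the missing pair. Once the link is shortened into
   [Om], the vertex [b] following [y] differs from [z], hence is adjacent to [x], which a hole
   forbids. *)
have yzuv : [set y; z] = [set u; v].
  by apply/eqP; apply/negPn/negP=> ne; rewrite (KOm y z) in nyz.
set U := (X in linked K X) in l.
have {}l : linked K (U :&: Om) y z.
  apply: (@linked_shortcut _ _ _ _ bd) => //.
  - move=> a b ab aO bO; have := Kstep a a b aO (comp_refl a) ab.
    rewrite in_setU => /orP[/bd_eq //|/(subsetP (bd_sub a))].
    by rewrite (negbTE bO).
  - move=> a b ab aO bO.
    have := Kstep b b a bO (comp_refl b); rewrite symK => /(_ ab).
    by rewrite in_setU => /orP[/(comp_notin bO)|//]; rewrite aO.
have [a [b [_ bU ab /eqP ay nb]]] :=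
  linked_crossing (P := pred1 y) l (eqxx y) (etrans (congr1 negb (eq_sym z y)) yz).
rewrite {}ay in ab; rewrite /= in nb.
have bz : b != z by apply: contra nyz => /eqP <-.
move: bU; rewrite !inE (negbTE bz) (negbTE nb) /=.
case/andP=> /andP[bx nxb] bO; rewrite (KOm x b) // 1?eq_sym // in nxb.
apply/eqP=> e; have: b \in [set y; z] by rewrite yzuv e !inE eqxx orbT.
by rewrite !inE (negbTE bz) (negbTE nb).
Qed.

Lemma fill_sym F : symmetric (fill E F).
Proof. by move=> a b; rewrite /fill eq_sym symE setUC. Qed.

Lemma fill_irr F : irreflexive (fill E F).
Proof. by move=> a; rewrite /fill eqxx. Qed.

(* Otherwise, removing from the fill [u v] and all pairs that are neither in
   [Om] nor in one cell leaves a smaller triangulation. *)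
Lemma pmc_pair u v : potential_maximal_clique E Om ->
    u \in Om -> v \in Om -> u != v -> ~~ E u v ->
  exists d, [/\ d \notin Om, u \in bd d & v \in bd d].
Proof.
move=> [F [[[neF chF] minF] [clO maxO]]] uO vO uv nuv.
case: (boolP [exists d, [&& d \notin Om, u \in bd d & v \in bd d]]).
  by case/existsP=> d /and3P[]; exists d.
rewrite negb_exists => /forallP noD; exfalso.
have symH := fill_sym F; have irrH := fill_irr F.
have uvF : [set u; v] \in F.
  by have := clO u v uO vO uv; rewrite /fill uv (negbTE nuv).
pose ok e := (e != [set u; v]) && ((e \subset Om) ||
  [exists d, (d \notin Om) && (e \subset comp d :|: bd d)]).
pose F0 := [set e in F | ok e].
have F0F : F0 \proper F.
  apply/properP; split; first by apply/subsetP=> e; rewrite inE => /andP[].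
  by exists [set u; v]; rewrite ?uvF // inE uvF /ok eqxx.
apply: (minF F0 F0F); split=> [e|]; first by rewrite inE => /andP[/neF].
apply/(chordalP (fill_sym F0) (fill_irr F0)).
apply: (@glue_no_hole (fill E F) (fill E F0) u v (fill_sym F0) (fill_irr F0)).
- exact/(chordalP symH irrH).
- exact: clO.
- move=> d dO a b aL bL; rewrite /fill; congr (_ && (_ || _)).
  rewrite inE; case: ([set a; b] \in F) => //=.
  apply/andP; split.
    (* A pair inside the cell of [d] cannot be [u v]: both of these are in [Om], hence would be in
       [bd d]. *)
    apply: contra (noD d) => /eqP e; rewrite dO /=.
    have sub w : w \in [set a; b] -> w \in Om -> w \in bd d.
      case/set2P=> -> wO; move: aL bL; rewrite !in_setU.
        by case/orP=> [/(comp_notin dO)|//]; rewrite wO.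
      by move=> _ /orP[/(comp_notin dO)|//]; rewrite wO.
    by rewrite !sub // e !inE eqxx ?orbT.
  apply/orP; right; apply/existsP; exists d; rewrite dO /=.
  by apply/subsetP=> w /set2P[] ->.
- move=> d a b dO ad; rewrite /fill => /andP[ab /orP[|]]; first exact: comp_step.
  rewrite inE => /andP[_ /andP[_ /orP[/subsetP s|/existsP[d' /andP[d'O /subsetP s]]]]].
    by have := comp_notin dO ad; rewrite s // !inE eqxx.
  have: a \in comp d' :|: bd d' by apply: s; rewrite !inE eqxx.
  rewrite in_setU => /orP[ad'|/(subsetP (bd_sub _))]; last first.
    by rewrite (negbTE (comp_notin dO ad)).
  have: b \in comp d' :|: bd d' by apply: s; rewrite !inE eqxx orbT.
  by rewrite -(comp_eq ad') -(bd_eq ad') (comp_eq ad) (bd_eq ad).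
- move=> a b aO bO ab neuv; have := clO a b aO bO ab.
  rewrite /fill ab /= => /orP[-> //|abF]; rewrite inE abF /ok neuv /=.
  apply/orP; right; apply/orP; left.
  by apply/subsetP=> w; rewrite !inE => /orP[] /eqP ->.
by rewrite /fill (negbTE nuv) inE /ok eqxx /= andbF andbF.
Qed.

(** Otherwise take [d0] in [comp d] with the most filled neighbours in [Om]. By maximality of the
    clique [d0] misses some [w]; let [e] be the first neighbour of [w] on a walk from [d0]. If some
    neighbour [x] of [d0] in [Om] missed [e], walking back from [e] to the first neighbour [f] of
    [x] would give a hole at [x] between [f] and [w]. So [e] sees all that [d0] sees, and also [w],
    against the choice of [d0]. *)
Lemma pmc_not_full d : potential_maximal_clique E Om -> d \notin Om ->
  exists2 w, w \in Om & w \notin bd d.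
Proof.
move=> [F [[[neF chF] _] [clO maxO]]] dO.
apply/exists_inP; rewrite -[[exists _ in _, _]]negbK negb_exists_in.
apply/negP=> /forall_inP full.
have {}full w : w \in Om -> w \in bd d by move=> /full; rewrite negbK.
set H := fill E F in chF clO maxO.
have symH : symmetric H := fill_sym F; have irrH : irreflexive H := fill_irr F.
have EH a b : E a b -> H a b.
  by move=> ab; rewrite /H /fill ab andbT; apply: contraTneq ab => ->; rewrite irrE.
have noH := (chordalP symH irrH).1 chF.
pose N a := [set w in Om | H a w].
have [d0 d0d maxN] := @arg_maxnP _ d (mem (comp d)) (fun a => #|N a|) (comp_refl d).
have d0O := comp_notin dO d0d.
case: (boolP (Om \subset N d0)) => [/subsetP sub|/subsetPn[w wO nw]].
  apply: (maxO (d0 |: Om)).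
    apply/properP; split; first exact: subsetUr.
    by exists d0; rewrite ?setU11.
  move=> a b; rewrite !in_setU1 => /orP[/eqP ->|aO] /orP[/eqP ->|bO] ab.
  - by rewrite eqxx in ab.
  - by have := sub b bO; rewrite inE => /andP[].
  - by have := sub a aO; rewrite inE symH => /andP[].
  - exact: clO.
have {}nw : ~~ H d0 w by move: nw; rewrite inE wO.
have /bdP[_ [q qd qw]] := full w wO.
have l : linked H (comp d) d0 q.
  by apply: linked_subrel (comp_linked dO d0d qd) => a b _ _; apply: EH.
have nw' : ~~ H w d0 by rewrite symH.
have wq : H w q by rewrite symH EH.
have [e [ed we]] := linked_first_hit (P := H w) l nw' wq.
set U := (X in linked H X) => l1.
have eO := comp_notin dO ed.
suff : N d0 \proper N e by move/proper_card; rewrite ltnNge => /negP; apply; apply: maxN.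
apply/properP; split; last first.
  by exists w; rewrite !inE wO /= 1?symH.
apply/subsetP=> x; rewrite !inE => /andP[xO d0x]; rewrite xO /=.
apply/negPn/negP=> nex.
have {}nex : ~~ H x e by rewrite symH.
have xd0 : H x d0 by rewrite symH.
have l2 : linked H U e d0 by rewrite linked_sym.
have [f [fU xf]] := linked_first_hit (P := H x) l2 nex xd0.
set U' := (X in linked H X) => l3.
have fe : f != e by apply: contraNneq nex => <-.
have [fd nwf] : f \in comp d /\ ~~ H w f.
  by move: fU; rewrite in_setU1 (negbTE fe) in_set => /andP[].
have fO := comp_notin dO fd.
have xw : x != w by apply: contraTneq d0x => ->.
apply: (noH x f w); split=> //.
- exact: clO.
- by apply: contraNneq fO => ->.
- by rewrite symH.
have sub : U' \subset [set f; w] :|: [set w0 | (w0 != x) && ~~ H x w0].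
  apply/subsetP=> t; rewrite in_setU1 in_set => /orP[/eqP ->|/andP[tU nxt]].
    by rewrite !inE eqxx.
  rewrite !inE nxt andbT; apply/orP; right.
  have tO : t \notin Om.
    by move: tU; rewrite in_setU1 in_set => /orP[/eqP -> //|/andP[/(comp_notin dO)]].
  by apply: contraNneq tO => ->.
apply: (@connect_trans _ _ e).
  by rewrite -/(linked H _ _ _) linked_sym //; apply: linked_subset l3.
apply: linked1; last by rewrite symH.
  rewrite !inE nex andbT; apply/orP; right.
  by apply: contraNneq eO => ->.
by rewrite !inE eqxx orbT.
Qed.

End Components.

Local Open Scope ring_scope.

(** * Measure of minimal separators *)

Section Mass.
Variables (F : realFieldType) (T : finType) (m : T -> F).
Hypothesis m_ge0 : forall x, 0 <= m x.
Implicit Types X Y Z : {set T}.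

Definition mass X : F := \sum_(x in X) m x.

Lemma mass_ge0 X : 0 <= mass X.
Proof. exact: sumr_ge0. Qed.

Lemma mass_mono X Y : X \subset Y -> mass X <= mass Y.
Proof.
move=> /setIidPr XY; rewrite /mass [leRHS](big_setID X) /= XY lerDl.
exact: sumr_ge0.
Qed.

Lemma mass_setU X Y : mass (X :|: Y) <= mass X + mass Y.
Proof.
rewrite /mass (big_setID X) /= setIUl setIid (setUidPl (subsetIr Y X)) lerD2l.
by apply: mass_mono; rewrite subDset.
Qed.

Lemma mass_cover X Y Z : X \subset Y :|: Z -> mass X <= mass Y + mass Z.
Proof. by move=> /mass_mono /le_trans; apply; apply: mass_setU. Qed.

Lemma mass_lt_exists X Y : mass Y < mass X -> exists2 x, x \in X & x \notin Y.
Proof.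
move=> lt; apply/subsetPn; apply: contraTN lt => /mass_mono.
by rewrite -leNgt.
Qed.

(** Double counting: [r] has the same weight in pairs summed by rows or by columns. If every column
    exceeded [c], the nonnegative excesses would sum to at most 0, forcing every point of [Y] to
    have weight 0. *)
Lemma mass_average (r : rel T) Y c :
    {in Y, forall a, mass [set b in Y | r a b] <= c} -> 0 < mass Y ->
  exists2 b, b \in Y & mass [set a in Y | r a b] <= c.
Proof.
move=> rc Y0; apply/exists_inP; apply: contraTT Y0 => /exists_inPn big_.
have {}big_ b : b \in Y -> c < mass [set a in Y | r a b].
  by move=> /big_; rewrite ltNge.
have term_ge0 b : b \in Y -> 0 <= m b * (mass [set a in Y | r a b] - c).
  by move=> /big_ bc; rewrite mulr_ge0 // subr_ge0 ltW.
have sum0 : \sum_(b in Y) m b * (mass [set a in Y | r a b] - c) = 0.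
  apply/le_anti; rewrite sumr_ge0 ?andbT //.
  under eq_bigr do rewrite mulrBr.
  rewrite sumrB subr_le0 [X in X <= _](_ : _ = \sum_(a in Y) m a * mass [set b in Y | r a b]).
    by apply: ler_sum => a aY; rewrite ler_wpM2l // rc.
  transitivity (\sum_(b in Y) \sum_(a in Y) if r a b then m b * m a else 0).
    apply: eq_bigr => b _; rewrite /mass mulr_sumr -big_mkcondr.
    by apply: eq_bigl => a; rewrite inE.
  rewrite exchange_big; apply: eq_bigr => a _ /=; rewrite /mass mulr_sumr -big_mkcondr.
  by apply: eq_big => [b|b _]; [rewrite inE | rewrite mulrC].
rewrite -leNgt /mass big1 // => b bY; apply/eqP.
have /eqP := psumr_eq0P term_ge0 sum0 bY.
by rewrite mulf_eq0 subr_eq0 => /orP[//|]; rewrite gt_eqF ?big_.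
Qed.

End Mass.

(** * Induced paths through two sides of a separator *)

Section Separators.
Variables (T : finType) (E : rel T).
Hypotheses (symE : symmetric E) (irrE : irreflexive E).
Implicit Types (A B X S : {set T}) (a b p u v w z : T).

Definition nbhd v := [set x | E v x].

Definition starts_P4 A v : bool :=
  [exists a in A, exists b in A, exists c in A,
    [&& E v a, E a b & E b c] && [&& ~~ E v b, ~~ E v c & ~~ E a c]].

Lemma starts_P4P A v : reflect
  (exists a b c, [/\ a \in A, b \in A & c \in A] /\
    [/\ E v a, E a b & E b c] /\ [/\ ~~ E v b, ~~ E v c & ~~ E a c])
  (starts_P4 A v).
Proof.
apply: (iffP exists_inP) => [[a aA /exists_inP[b bA /exists_inP[c cA]]]|].
  by case/andP=> /and3P[? ? ?] /and3P[? ? ?]; exists a, b, c.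
move=> [a [b [c [[aA bA cA] [[va ab bc] [vb vc ac]]]]]].
exists a => //; apply/exists_inP; exists b => //; apply/exists_inP; exists c => //.
by apply/andP; split; apply/and3P.
Qed.

(* Let [C v] be the component of [p] in [A] minus the neighbourhood of [v].
   As no induced P4 leads from [v] into [A], every vertex of [A] attached to
   [C v] is adjacent to [v] and to all of [C v]; [z v] is such a vertex, and
   [r u v] says that [C u] is included in [C v]. *)
Lemma avoided_components A p X :
    {in A &, forall a b, linked E A a b} -> p \in A ->
    {in X, forall v, [/\ ~~ E v p, exists2 a, a \in A & E v a & ~~ starts_P4 A v]} ->
  exists (z : T -> T) (r : rel T), {in X, forall v,
    [/\ z v \in A, E v (z v), {in X, forall u, r u v -> E u (z v)} &
     {in X, forall u, ~~ r v u -> ~~ E u (z v) ->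
       exists w, [/\ w \in A, E u w, E w (z v) & ~~ E w v]}]}.
Proof.
move=> connA pA XP.
pose U v := [set a in A | ~~ E v a].
pose C v := [set a | linked E (U v) p a].
have pC v : p \in C v by rewrite inE; apply: connect0.
have CU v c : v \in X -> c \in C v -> c \in U v.
  move=> /XP[vp _ _]; rewrite inE => /linked_mem; apply.
  by rewrite inE pA.
have CA v c : v \in X -> c \in C v -> c \in A.
  by move=> vX /(CU _ _ vX); rewrite inE => /andP[].
have Cv v c : v \in X -> c \in C v -> ~~ E v c.
  by move=> vX /(CU _ _ vX); rewrite inE => /andP[].
have attached v c a : v \in X -> c \in C v -> a \in A -> a \notin C v -> E c a -> E v a.
  move=> vX cC aA aC ca; apply: contraNT aC => va; have cU := CU _ _ vX cC.
  move: cC; rewrite !inE => pc; apply: connect_trans pc (linked1 cU _ ca).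
  by rewrite inE aA.
have complete v c a : v \in X -> c \in C v -> a \in A -> a \notin C v -> E c a ->
    {in C v, forall c', E a c'}.
  move=> vX cC aA aC ca c' c'C; apply/negPn/negP=> nac'.
  have va := attached _ _ _ vX cC aA aC ca.
  have l : linked E (U v) c c'.
    have pc : linked E (U v) p c by rewrite inE in cC.
    have pc' : linked E (U v) p c' by rewrite inE in c'C.
    by apply: connect_trans pc'; rewrite -/(linked E _ _ _) linked_sym.
  have ac : E a c by rewrite symE.
  (* At an edge [x y] where adjacency to [a] stops, [v a x y] is an induced P4 starting at [v] into
     [A]. *)
  have [x [y [xU yU xy ax nay]]] := linked_crossing l ac nac'.
  have [_ _ /negP] := XP v vX; apply; apply/starts_P4P; exists a, x, y.
  by move: xU yU; rewrite !inE => /andP[-> ->] /andP[-> ->].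
have ex_z v : exists z, v \in X ->
    [/\ z \in A, E v z & {in C v, forall c, E z c}].
  case: (boolP (v \in X)) => vX; last by exists v.
  have [_ [q qA vq] _] := XP v vX.
  have nq : q \notin C v by apply: contraL vq => /Cv; apply.
  have [c [z [_ zA cz cC zC]]] :=
    linked_crossing (P := mem (C v)) (connA p q pA qA) (pC v) nq.
  by exists z => _; split=> //; [apply: attached cz | apply: complete cz].
have [z zP] := fin_all_exists ex_z.
(* The vertex [p] belongs to every [C u], and [z v] is adjacent to all of [C v]; so [z v] is
   attached to [C u] through [p] unless it lies in it. *)
have zC v u : v \in X -> u \in X -> z v \notin C u -> E u (z v).
  move=> vX uX zC; have [zA vz zc] := zP v vX.
  by apply: (attached u p) => //; rewrite symE zc.
exists z, (fun u v => C u \subset C v) => v vX; have [zA vz zc] := zP v vX.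
split=> // [u uX /subsetP sub|u uX /subsetPn[w wCv wCu] nuz].
  by apply: zC => //; apply: contraL vz => /sub /Cv; apply.
(* Here [w] is in [C v] but not in [C u], while its neighbour [z v] is in [C u]. So [w] is attached
   to [C u] and adjacent to [u]. *)
have zCu : z v \in C u by apply: contraR nuz => /zC; apply.
have wz := zc w wCv; have wA := CA _ _ vX wCv.
exists w; split=> //; [exact: attached wz | by rewrite symE | by rewrite symE Cv].
Qed.

Hypothesis noP7 : Pk_free E 7.

Lemma no_ipath7 s : ipath E s -> (7 <= size s)%nat -> False.
Proof. by move=> ips s7; apply: noP7; apply: ipath_has_induced_path ips s7. Qed.

Variables (F : realFieldType) (m : T -> F) (beta : F).
Hypothesis m_ge0 : forall x, 0 <= m x.
Hypothesis nbhd_small : forall v, mass m (nbhd v) <= beta.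
Variables A B : {set T}.
Hypotheses (connA : {in A &, forall a b, linked E A a b})
  (connB : {in B &, forall a b, linked E B a b})
  (antiAB : {in A & B, forall a b, ~~ E a b}).

Let antiBA : {in B & A, forall a b, ~~ E a b}.
Proof. by move=> a b aB bA; rewrite symE antiAB. Qed.

Ltac path7 l := apply: (@no_ipath7 l) => //; rewrite /=;
  do ![apply/andP; split]; first [done | by rewrite symE | exact: antiAB | exact: antiBA].

(** One [beta] is spent on making [p] nonadjacent to all points. Averaging picks [v2] for which at
    most [beta] of the points [v1] satisfy [r v2 v1]; excluding these and the neighbours of [z v2],
    [v2], [b1], [b2], [b3] costs [6 * beta]. Any remaining [v1] gives the induced path
    [v1 w (z v2) v2 b1 b2 b3]. *)
Lemma mass_P4_one_side X p : p \in A ->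
    {in X, forall v, [/\ exists2 a, a \in A & E v a,
       ~~ starts_P4 A v & starts_P4 B v]} ->
  mass m X <= 7 * beta.
Proof.
move=> pA XP; rewrite leNgt; apply/negP=> big_X.
have beta0 : 0 <= beta := le_trans (mass_ge0 m_ge0 _) (nbhd_small p).
pose X' := X :\: nbhd p.
have X'X v : v \in X' -> v \in X by rewrite inE => /andP[].
have big_X' : 6 * beta < mass m X'.
  have : mass m X <= mass m (nbhd p) + mass m X'.
    by apply: mass_cover; rewrite // -subDset.
  have := nbhd_small p; lra.
have [|z [r zr]] := @avoided_components A p X' connA pA.
  move=> v vX'; have [? ? _] := XP v (X'X v vX'); split=> //.
  by move: vX'; rewrite !inE symE => /andP[].
have [||v2 v2X rv2] := @mass_average _ _ m m_ge0 (fun a b => r b a) X' beta.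
- move=> a aX'; have [_ _ ra _] := zr a aX'.
  apply: le_trans (nbhd_small (z a)); apply: mass_mono => //.
  by apply/subsetP=> b /setIdP[bX rba]; rewrite in_set symE; apply: ra.
- lra.
have [zA v2z _ zw] := zr v2 v2X.
have [_ _ /starts_P4P] := XP v2 (X'X v2 v2X).
move=> [b1 [b2 [b3 [[b1B b2B b3B] [[vb1 b12 b23] [nvb2 nvb3 nb13]]]]]].
pose bad := [set a in X' | r v2 a] :|: (nbhd (z v2) :|: (nbhd v2 :|:
  (nbhd b1 :|: (nbhd b2 :|: nbhd b3)))).
have [|v1 v1X] := @mass_lt_exists _ _ m m_ge0 X' bad.
  apply: le_lt_trans big_X'; rewrite (_ : 6 * beta =
    beta + (beta + (beta + (beta + (beta + beta))))); last by ring.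
  by do 5 (apply: le_trans (mass_setU m_ge0 _ _) (lerD _ _)) => //.
rewrite !in_setU in_set v1X !in_set !negb_or /= => /and5P[nr nz n2 nb1 /andP[nb2 nb3]].
have [|w [wA v1w wz nwv2]] := zw v1 v1X nr; first by rewrite symE.
path7 [:: v1; w; z v2; v2; b1; b2; b3].
Qed.

(** The forbidden path is [v1 (wA v1) (zA v2) v2 (zB v2) (wB v3) v3]. Avoiding the neighbours of [p]
    and [q] costs [2 * beta], and what is bad for [v2] costs [5 * beta], the comparisons in [A] and
    in [B] counting separately. A second averaging picks [v3] adjacent to [wA v1] for few [v1], and
    the choice of [v1] costs the last [3 * beta]. *)
Lemma mass_no_P4 X p q : p \in A -> q \in B ->
    {in X, forall v, [/\ exists2 a, a \in A & E v a, exists2 b, b \in B & E v b,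
       ~~ starts_P4 A v & ~~ starts_P4 B v]} ->
  mass m X <= 10 * beta.
Proof.
move=> pA qB XP; rewrite leNgt; apply/negP=> big_X.
have beta0 : 0 <= beta := le_trans (mass_ge0 m_ge0 _) (nbhd_small p).
pose X' := X :\: (nbhd p :|: nbhd q).
have X'X v : v \in X' -> v \in X by rewrite inE => /andP[].
have big_X' : 8 * beta < mass m X'.
  have : mass m X <= mass m (nbhd p :|: nbhd q) + mass m X'.
    by apply: mass_cover; rewrite // -subDset.
  have := mass_setU m_ge0 (nbhd p) (nbhd q).
  have := nbhd_small p; have := nbhd_small q; lra.
have [|zA [rA zrA]] := @avoided_components A p X' connA pA.
  move=> v vX'; have [? _ ? _] := XP v (X'X v vX'); split=> //.
  by move: vX'; rewrite !inE negb_or symE => /andP[/andP[]].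
have [|zB [rB zrB]] := @avoided_components B q X' connB qB.
  move=> v vX'; have [_ ? _ ?] := XP v (X'X v vX'); split=> //.
  by move: vX'; rewrite !inE negb_or (symE v) => /andP[/andP[]].
have [||v2 v2X rv2] :=
    @mass_average _ _ m m_ge0 (fun a b => rA b a || rB b a) X' (beta + beta).
- move=> a aX'; have [_ _ ra _] := zrA a aX'; have [_ _ rb _] := zrB a aX'.
  apply: le_trans (lerD (nbhd_small (zA a)) (nbhd_small (zB a))).
  apply: mass_cover => //; apply/subsetP=> b /setIdP[bX].
  by case/orP=> [rba|rba]; apply/setUP; [left | right]; rewrite in_set symE;
    [apply: ra | apply: rb].
- lra.
have [zA_A v2zA _ zwA] := zrA v2 v2X; have [zB_B v2zB _ zwB] := zrB v2 v2X.
pose bad := [set a in X' | rA v2 a || rB v2 a] :|: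
  (nbhd (zA v2) :|: (nbhd (zB v2) :|: nbhd v2)).
pose Y := X' :\: bad.
have big_Y : 3 * beta < mass m Y.
  have : mass m X' <= mass m bad + mass m Y.
    by apply: mass_cover; rewrite // -subDset.
  have : mass m bad <= (beta + beta) + (beta + (beta + beta)).
    by do 3 (apply: le_trans (mass_setU m_ge0 _ _) (lerD _ _)) => //.
  lra.
have YP v : v \in Y -> [/\ v \in X', ~~ rA v2 v & ~~ rB v2 v] /\
    [/\ ~~ E (zA v2) v, ~~ E (zB v2) v & ~~ E v2 v].
  rewrite in_setD => /andP[nbad vX]; move: nbad.
  by rewrite !in_setU in_set vX !in_set !negb_or /= -andbA => /and5P[].
have exwA v : exists w, v \in Y -> [/\ w \in A, E v w, E w (zA v2) & ~~ E w v2].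
  case: (boolP (v \in Y)) => [/YP[[vX ra _] [nz _ _]]|_]; last by exists v.
  by have [|w wP] := zwA v vX ra; [rewrite symE | exists w].
have exwB v : exists w, v \in Y -> [/\ w \in B, E v w, E w (zB v2) & ~~ E w v2].
  case: (boolP (v \in Y)) => [/YP[[vX _ rb] [_ nz _]]|_]; last by exists v.
  by have [|w wP] := zwB v vX rb; [rewrite symE | exists w].
have [wA wAP] := fin_all_exists exwA; have [wB wBP] := fin_all_exists exwB.
have [||v3 v3Y rv3] := @mass_average _ _ m m_ge0 (fun a b => E (wA a) b) Y beta.
- move=> a aY; apply: le_trans (nbhd_small (wA a)); apply: mass_mono => //.
  by apply/subsetP=> b /setIdP[_]; rewrite in_set.
- lra.
have [|v1 v1Y] := @mass_lt_exists _ _ m m_ge0 Y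
    ([set a in Y | E (wA a) v3] :|: (nbhd v3 :|: nbhd (wB v3))).
  apply: le_lt_trans big_Y; rewrite (_ : 3 * beta = beta + (beta + beta)); last by ring.
  by do 2 (apply: le_trans (mass_setU m_ge0 _ _) (lerD _ _)) => //.
rewrite !in_setU in_set v1Y !in_set !negb_or /= => /and3P[nw1 n3 nw3].
have [_ [nzA1 nzB1 n21]] := YP v1 v1Y; have [_ [nzA3 nzB3 n23]] := YP v3 v3Y.
have [w1A v1w w1z nw1v2] := wAP v1 v1Y; have [w3B v3w w3z nw3v2] := wBP v3 v3Y.
path7 [:: v1; wA v1; zA v2; v2; zB v2; wB v3; v3].
Qed.

End Separators.

(** No vertex starts an induced P4 into both sides, since the two would join into an induced P7. The
    remaining cases, a P4 into [B] only, into [A] only, or into neither, contribute 7 + 7 + 10. *)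
Lemma mass_separator (T : finType) (E : rel T) (F : realFieldType)
    (m : T -> F) (beta : F) (A B S : {set T}) p q :
    symmetric E -> irreflexive E -> Pk_free E 7 ->
    (forall x, 0 <= m x) -> (forall v, mass m (nbhd E v) <= beta) ->
    {in A &, forall a b, linked E A a b} ->
    {in B &, forall a b, linked E B a b} ->
    {in A & B, forall a b, ~~ E a b} -> p \in A -> q \in B ->
    {in S, forall v, (exists2 a, a \in A & E v a) /\ (exists2 b, b \in B & E v b)} ->
  mass m S <= 24 * beta.
Proof.
move=> symE irrE noP7 m0 small connA connB antiAB pA qB SP.
have antiBA : {in B & A, forall a b, ~~ E a b}.
  by move=> a b aB bA; rewrite symE antiAB.
pose P4A := starts_P4 E A; pose P4B := starts_P4 E B.
have cover : S \subset [set v in S | ~~ P4A v && P4B v] :|: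
    ([set v in S | ~~ P4B v && P4A v] :|: [set v in S | ~~ P4A v && ~~ P4B v]).
  apply/subsetP=> v vS; rewrite !inE vS /=.
  case: (boolP (P4A v)) => [/starts_P4P|]; last by case: (P4B v).
  move=> [a1 [a2 [a3 [[a1A a2A a3A] [[va1 a12 a23] [nva2 nva3 na13]]]]]].
  case: (boolP (P4B v)) => [/starts_P4P|//].
  move=> [b1 [b2 [b3 [[b1B b2B b3B] [[vb1 b12 b23] [nvb2 nvb3 nb13]]]]]].
  exfalso; apply: (no_ipath7 symE irrE noP7 (s := [:: a3; a2; a1; v; b1; b2; b3])) => //.
  by rewrite /=; do ![apply/andP; split]; first [done | by rewrite symE | exact: antiAB].
have h1 : mass m [set v in S | ~~ P4A v && P4B v] <= 7 * beta.
  apply: (mass_P4_one_side symE irrE noP7 m0 small connA antiAB pA) => v.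
  by rewrite inE => /andP[/SP[? ?] /andP[]].
have h2 : mass m [set v in S | ~~ P4B v && P4A v] <= 7 * beta.
  apply: (mass_P4_one_side symE irrE noP7 m0 small connB antiBA qB) => v.
  by rewrite inE => /andP[/SP[? ?] /andP[]].
have h3 : mass m [set v in S | ~~ P4A v && ~~ P4B v] <= 10 * beta.
  apply: (mass_no_P4 symE irrE noP7 m0 small connA connB antiAB pA qB) => v.
  by rewrite inE => /andP[/SP[? ?] /andP[]].
have := mass_cover m0 cover.
have := mass_setU m0 [set v in S | ~~ P4B v && P4A v] [set v in S | ~~ P4A v && ~~ P4B v].
lra.
Qed.

(** * Measure of potential maximal cliques *)

Section ProductMass.
Variables (F : realFieldType) (X Y : finType) (m : X -> F) (n : Y -> F).
Hypotheses (m_ge0 : forall x, 0 <= m x) (n_ge0 : forall y, 0 <= n y).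
Hypotheses (m1 : mass m setT = 1) (n1 : mass n setT = 1).

Definition prod_mass (t : X * Y) : F := m t.1 * n t.2.

Lemma prod_mass_ge0 t : 0 <= prod_mass t.
Proof. exact: mulr_ge0. Qed.

Lemma mass_prod_fibers (Z : {set X * Y}) :
  mass prod_mass Z = \sum_x m x * mass n [set y | (x, y) \in Z].
Proof.
transitivity (\sum_x \sum_(y | (x, y) \in Z) m x * n y).
  by rewrite pair_big_dep; apply: eq_big => [[x y]|[x y]].
by apply: eq_bigr => x _; rewrite /mass mulr_sumr; apply: eq_bigl => y; rewrite inE.
Qed.

Lemma mass_prodT : mass prod_mass setT = 1.
Proof.
rewrite mass_prod_fibers -m1 /mass; apply: eq_big => [x|x _]; first by rewrite inE.
rewrite -[RHS]mulr1 -n1 /mass; congr (_ * _).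
by apply: eq_bigl => y; rewrite !inE.
Qed.

Lemma mass_fiber_r (Z : {set X * Y}) k :
  (forall x, mass n [set y | (x, y) \in Z] <= k) -> mass prod_mass Z <= k.
Proof.
move=> Zk; rewrite mass_prod_fibers.
apply: (@le_trans _ _ (\sum_x m x * k)).
  by apply: ler_sum => x _; rewrite ler_wpM2l.
rewrite -mulr_suml (_ : \sum_x m x = 1) ?mul1r // -m1 /mass.
by apply: eq_bigl => x; rewrite inE.
Qed.

End ProductMass.

Lemma mass_fiber_l (F : realFieldType) (X Y : finType) (m : X -> F) (n : Y -> F)
    (Z : {set X * Y}) k :
    (forall y, 0 <= n y) -> mass n setT = 1 ->
    (forall y, mass m [set x | (x, y) \in Z] <= k) ->
  mass (prod_mass m n) Z <= k.
Proof.
move=> n0 n1 Zk; pose Z' := [set t | (t.2, t.1) \in Z].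
suff -> : mass (prod_mass m n) Z = mass (prod_mass n m) Z'.
  apply: mass_fiber_r => // y; rewrite (_ : [set _ | _] = [set x | (x, y) \in Z]) //.
  by apply/setP=> x; rewrite !inE.
rewrite /mass (reindex (fun t : Y * X => (t.2, t.1))) /=; last first.
  by exists (fun t : X * Y => (t.2, t.1)) => [[]|[]].
by apply: eq_big => [t|t _]; [rewrite !inE | rewrite /prod_mass mulrC].
Qed.

(** * An induced path through three components *)

Section FourPoints.
Variables (T : finType) (E : rel T) (Om : {set T}).
Hypotheses (symE : symmetric E) (irrE : irreflexive E).
Hypothesis noP7 : Pk_free E 7.
Implicit Types (d u v : T).

Lemma comp_segment d u v : d \notin Om -> u \in bd E Om d -> v \in bd E Om d ->
    u != v -> ~~ E u v ->
  exists s, [/\ ipath E (u :: rcons s v), {subset s <= comp E Om d} & (0 < size s)%nat].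
Proof.
move=> dO /bdP[_ [a ad au]] /bdP[_ [b bd_ bv]] uv nuv.
pose U := [set u; v] :|: comp E Om d.
have uU : u \in U by rewrite !in_setU in_set1 eqxx.
have vU : v \in U by rewrite !in_setU !in_set1 eqxx orbT.
have cU : comp E Om d \subset U by apply: subsetUr.
have l : linked E U u v.
  apply: (@connect_trans _ _ a).
    by apply: linked1; rewrite // ?(subsetP cU) // symE.
  apply: connect_trans (linked1 (subsetP cU b bd_) vU bv).
  exact: linked_subset cU (comp_linked symE dO ad bd_).
have [s [ips lst us sU]] := linked_ipath l.
case/lastP: s lst ips us sU => [/eqP|s w]; first by rewrite (negbTE uv).
rewrite last_rcons => -> ips us sU; exists s; split=> //.
  move=> x xs; have xU : x \in U by apply: sU; rewrite mem_rcons inE xs orbT.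
  move: us; rewrite cons_uniq rcons_uniq mem_rcons inE negb_or.
  case/and3P=> /andP[_ us] vs _.
  case/setUP: xU => // /set2P[] e; first by rewrite e (negbTE us) in xs.
  by rewrite -e xs in vs.
by case: s ips {us sU} => //; rewrite /= (negbTE nuv).
Qed.

Lemma comp_nonadjacent d a b : d \notin Om -> a \in comp E Om d ->
  b \notin comp E Om d -> b \notin bd E Om d -> ~~ E a b.
Proof.
move=> dO ad nb nb'; apply: contra nb => /(comp_step symE dO ad).
by rewrite in_setU (negbTE nb') orbF.
Qed.

(** Three induced segments through the components are concatenated at [u2] and [u3]. The components
    are distinct, hence mutually nonadjacent, because their boundaries differ at one of the points.
    Each segment has at least one inner vertex, so the whole has at least 4 + 3 vertices. *)
Lemma four_points d1 d2 d3 u1 u2 u3 u4 :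
    d1 \notin Om -> d2 \notin Om -> d3 \notin Om ->
    u1 \in bd E Om d1 -> u2 \in bd E Om d1 -> u2 \in bd E Om d2 ->
    u3 \in bd E Om d2 -> u3 \in bd E Om d3 -> u4 \in bd E Om d3 ->
    u3 \notin bd E Om d1 -> u4 \notin bd E Om d1 ->
    u1 \notin bd E Om d2 -> u4 \notin bd E Om d2 ->
    u1 \notin bd E Om d3 -> u2 \notin bd E Om d3 ->
    ~~ E u1 u2 -> ~~ E u1 u3 -> ~~ E u1 u4 -> ~~ E u2 u3 -> ~~ E u2 u4 ->
    ~~ E u3 u4 -> u1 != u2 -> u2 != u3 -> u3 != u4 ->
  False.
Proof.
move=> d1O d2O d3O u11 u21 u22 u32 u33 u43 u31 u41 u12 u42 u13 u23.
move=> n12 n13 n14 n23 n24 n34 e12 e23 e34.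
have BO d u : u \in bd E Om d -> u \in Om by apply: (subsetP (bd_sub E Om d)).
have NO d u : d \notin Om -> u \in Om -> u \notin comp E Om d.
  by move=> dO uO; apply/negP=> /(comp_notin dO); rewrite uO.
have u1O := BO _ _ u11.
have u2O := BO _ _ u21; have u3O := BO _ _ u32; have u4O := BO _ _ u43.
have far d d' u : d \notin Om -> d' \notin Om -> u \in bd E Om d' -> u \notin bd E Om d ->
    {in comp E Om d & comp E Om d', forall a b, ~~ E a b}.
  move=> dO d'O ud' ud a b ad bd'; apply: (comp_nonadjacent dO ad).
    apply: contra ud => bd_; by rewrite -(bd_eq symE bd_) (bd_eq symE bd').
  by apply: contra (comp_notin d'O bd') => /BO.
have cv d u : d \notin Om -> u \in Om -> u \notin bd E Om d ->
    {in comp E Om d, forall a, ~~ E a u}.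
  by move=> dO uO ud a ad; apply: (comp_nonadjacent dO ad) => //; apply: NO.
have vc d u : d \notin Om -> u \in Om -> u \notin bd E Om d ->
    {in comp E Om d, forall a, ~~ E u a}.
  by move=> dO uO ud a ad; rewrite symE; apply: cv ad.
have [s1 [p1 c1 z1]] := comp_segment d1O u11 u21 e12 n12.
have [s2 [p2 c2 z2]] := comp_segment d2O u22 u32 e23 n23.
have [s3 [p3 c3 z3]] := comp_segment d3O u33 u43 e34 n34.
have p23 : ipath E (u2 :: s2 ++ u3 :: rcons s3 u4).
  rewrite -cat_cons; apply: ipath_cat => // a b; rewrite inE mem_rcons inE.
  case/predU1P=> [->|/c2 aC] /predU1P[->|/c3 bC] //.
  - exact: vc bC.
  - exact: cv aC.
  - exact: (far d2 d3 u4) aC bC.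
have p123 : ipath E (u1 :: s1 ++ u2 :: s2 ++ u3 :: rcons s3 u4).
  rewrite -cat_cons; apply: ipath_cat => // a b; rewrite inE mem_cat inE mem_rcons inE.
  case/predU1P=> [->|/c1 aC].
    case/or4P=> [/c2 bC|/eqP ->|/eqP ->|/c3 bC] //; exact: vc bC.
  case/or4P=> [/c2 bC|/eqP ->|/eqP ->|/c3 bC]; try exact: cv aC.
    exact: (far d1 d2 u3) aC bC.
  exact: (far d1 d3 u4) aC bC.
apply: (no_ipath7 symE irrE noP7 p123).
rewrite /= size_cat /= size_cat /= size_rcons. clear -z1 z2 z3; lia.
Qed.

End FourPoints.

(** * Random choice of four points in the clique *)

Section LargeNeighbourhood.
Variables (T : finType) (E : rel T) (Om : {set T}).
Hypotheses (symE : symmetric E) (irrE : irreflexive E).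
Hypotheses (noP7 : Pk_free E 7) (pmcO : potential_maximal_clique E Om).
Variables (F : realFieldType) (m : T -> F) (beta : F).
Hypothesis m_ge0 : forall x, 0 <= m x.
Hypothesis nbhd_small : forall v, mass m (nbhd E v) <= beta.

(** The second side is the component of [w] in the complement of [S], where [w] is a point of [Om]
    outside [S]. A vertex [s] of [S] nonadjacent to [w] shares with it the boundary of a component
    [d'] of the complement of [Om]; this component avoids [S] and is attached to [w], so it lies on
    the second side. *)
Lemma mass_bd d : d \notin Om -> mass m (bd E Om d) <= 24 * beta.
Proof.
move=> dO; have [w wO wd] := pmc_not_full symE irrE pmcO dO.
set S := bd E Om d in wd *; have SO : S \subset Om := bd_sub E Om d.
have step a b : a \in comp E Om d -> E a b -> b \in comp E Om d :|: S.
  exact: comp_step.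
have disj b : b \in comp E S w -> b \notin comp E Om d.
  rewrite inE => wb; apply/negP=> bd_.
  have nw : w \notin comp E Om d by apply/negP=> /(comp_notin dO); rewrite wO.
  have wb' : linked E (~: S) b w by rewrite linked_sym.
  have [x [y [_ yS xy xd nyd]]] :=
    linked_crossing (P := mem (comp E Om d)) wb' bd_ nw.
  have := step x y xd xy; rewrite in_setU => /orP[yd|].
    by rewrite /= yd in nyd.
  by apply/negP; rewrite -in_setC.
apply: (mass_separator symE irrE noP7 m_ge0 nbhd_small
  (A := comp E Om d) (B := comp E S w) (p := d) (q := w)).
- by move=> a b ad bd_; apply: comp_linked.
- by move=> a b ad bd_; apply: comp_linked.
- move=> a b ad bw; apply/negP=> /(step _ _ ad); rewrite in_setU.
  by rewrite (negbTE (disj b bw)) (negbTE (comp_notin wd bw)).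
- exact: comp_refl.
- exact: comp_refl.
move=> s sS; split; first by have /bdP[_ [x xd xs]] := sS; exists x; rewrite // symE.
case: (boolP (E s w)) => sw; first by exists w; rewrite ?comp_refl.
have sO := subsetP SO s sS.
have ne : s != w by apply: contraTneq sS => ->.
have [d' [d'O /bdP[_ [x xd' xs]] /bdP[_ [y yd' yw]]]] := pmc_pair symE pmcO sO wO ne sw.
exists x; last by rewrite symE.
have yS : y \in ~: S.
  by rewrite inE; apply: contra (comp_notin d'O yd') => /(subsetP SO).
rewrite inE; apply: (@connect_trans _ _ y).
  by apply: linked1; [rewrite inE | | rewrite symE].
apply: (linked_subset (U := comp E Om d')) (comp_linked symE d'O yd' xd').
apply/subsetP=> t td'; rewrite inE.
by apply: contra (comp_notin d'O td') => /(subsetP SO).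
Qed.

Hypotheses (m1 : mass m setT = 1) (mO : forall x, x \notin Om -> m x = 0).
Hypothesis has_nbr : forall x, exists y, E y x.

(** Union bound: the events constraining the first, second, third and fourth point cost 50, 26, 28
    and 54 times [beta], in total 158. *)
Lemma large_neighbourhood : 1 <= 158 * beta.
Proof.
rewrite leNgt; apply/negP=> small.
have [x0 _] : exists2 x, x \in setT & x \notin (set0 : {set T}).
  by apply: (@mass_lt_exists _ _ m m_ge0); rewrite m1 /mass big_set0.
have beta0 : 0 <= beta := le_trans (mass_ge0 m_ge0 _) (nbhd_small x0).
pose P u v d := [&& d \notin Om, u \in bd E Om d & v \in bd E Om d].
(* The default [u] need not satisfy [P]; [ND] is then empty, so that its bound holds for all pairs
   without conditions. *)
pose D u v := odflt u [pick d | P u v d].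
pose ND u v := if P u v (D u v) then bd E Om (D u v) else set0.
have ND_small u v : mass m (ND u v) <= 24 * beta.
  rewrite /ND; case: ifP => [/and3P[dO _ _]|_]; first exact: mass_bd.
  by rewrite /mass big_set0 mulr_ge0.
have [cl [cl_small clP]] : exists cl : T -> {set T},
    (forall u, mass m (cl u) <= 2 * beta) /\
    forall u v, v \notin cl u -> [/\ v \in Om, u != v & ~~ E u v].
  (* The complement of [Om] has measure 0, and [u] alone weighs at most [beta] because it lies in
     the neighbourhood of one of its neighbours. *)
  exists (fun u => ~: Om :|: (u |: nbhd E u)); split=> [u|u v]; last first.
    by rewrite !inE !negb_or negbK eq_sym => /and3P.
  have h0 : mass m (~: Om) = 0 by apply: big1 => x; rewrite inE => /mO.
  have [y yu] := has_nbr u.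
  have hu : mass m [set u] <= beta.
    apply: le_trans (nbhd_small y); apply: mass_mono => //.
    by rewrite sub1set inE.
  have := mass_setU m_ge0 (~: Om) (u |: nbhd E u).
  have := mass_setU m_ge0 [set u] (nbhd E u).
  have := nbhd_small u; lra.
have DP u v : u \in Om -> v \notin cl u ->
    [/\ D u v \notin Om, u \in bd E Om (D u v), v \in bd E Om (D u v) &
      ND u v = bd E Om (D u v)].
  move=> uO /clP[vO uv nuv]; have [d [dO ud vd]] := pmc_pair symE pmcO uO vO uv nuv.
  have PD : P u v (D u v).
    by rewrite /D; case: pickP => // /(_ d); rewrite /P dO ud vd.
  by rewrite /ND PD; case/and3P: PD.
(* The four points are drawn independently; each bad event constrains one of
   them to a small set depending on the others. *)
pose m2 := prod_mass m m; pose m4 := prod_mass m2 m2.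
have m2_ge0 t : 0 <= m2 t by apply: prod_mass_ge0.
have m4_ge0 t : 0 <= m4 t by apply: prod_mass_ge0.
have m21 : mass m2 setT = 1 by apply: mass_prodT.
have m41 : mass m4 setT = 1 by apply: mass_prodT.
have ev1 f k : (forall a b c, mass m (f a b c) <= k) ->
    mass m4 [set t | t.1.1 \in f t.1.2 t.2.1 t.2.2] <= k.
  move=> fk; apply: mass_fiber_l => // -[c d]; apply: mass_fiber_l => // b.
  by apply: le_trans (fk b c d); apply: mass_mono => //; apply/subsetP=> a; rewrite !inE.
have ev2 f k : (forall a b c, mass m (f a b c) <= k) ->
    mass m4 [set t | t.1.2 \in f t.1.1 t.2.1 t.2.2] <= k.
  move=> fk; apply: mass_fiber_l => // -[c d]; apply: mass_fiber_r => // a.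
  by apply: le_trans (fk a c d); apply: mass_mono => //; apply/subsetP=> b; rewrite !inE.
have ev3 f k : (forall a b c, mass m (f a b c) <= k) ->
    mass m4 [set t | t.2.1 \in f t.1.1 t.1.2 t.2.2] <= k.
  move=> fk; apply: mass_fiber_r => // -[a b]; apply: mass_fiber_l => // d.
  by apply: le_trans (fk a b d); apply: mass_mono => //; apply/subsetP=> c; rewrite !inE.
have ev4 f k : (forall a b c, mass m (f a b c) <= k) ->
    mass m4 [set t | t.2.2 \in f t.1.1 t.1.2 t.2.1] <= k.
  move=> fk; apply: mass_fiber_r => // -[a b]; apply: mass_fiber_r => // c.
  by apply: le_trans (fk a b c); apply: mass_mono => //; apply/subsetP=> d; rewrite !inE.
pose U4 := ((T * T) * (T * T))%type.
(* The event with [cl] in [bad1] serves to place the first point in [Om]; those in [bad2], [bad3]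
   and [bad4] make the six pairs nonadjacent. *)
pose bad1 := [set t : U4 | t.1.1 \in cl t.1.2] :|: ([set t : U4 | t.1.1 \in ND t.1.2 t.2.1]
   :|: [set t : U4 | t.1.1 \in ND t.2.1 t.2.2]).
pose bad2 := [set t : U4 | t.1.2 \in cl t.1.1] :|: [set t : U4 | t.1.2 \in ND t.2.1 t.2.2].
pose bad3 := [set t : U4 | t.2.1 \in cl t.1.1] :|: ([set t : U4 | t.2.1 \in cl t.1.2]
   :|: [set t : U4 | t.2.1 \in ND t.1.1 t.1.2]).
pose bad4 := [set t : U4 | t.2.2 \in cl t.1.1] :|: ([set t : U4 | t.2.2 \in cl t.1.2]
   :|: ([set t : U4 | t.2.2 \in cl t.2.1]
   :|: ([set t : U4 | t.2.2 \in ND t.1.1 t.1.2] :|: [set t : U4 | t.2.2 \in ND t.1.2 t.2.1]))).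
have split2 X Y (k l : F) : mass m4 X <= k -> mass m4 Y <= l -> mass m4 (X :|: Y) <= k + l.
  by move=> Xk Yl; apply: le_trans (mass_setU m4_ge0 _ _) (lerD Xk Yl).
have h1 : mass m4 bad1 <= 2 * beta + (24 * beta + 24 * beta).
  apply: (split2); first exact: (ev1 (fun a _ _ => cl a)).
  apply: (split2); first exact: (ev1 (fun a b _ => ND a b)).
  exact: (ev1 (fun _ b c => ND b c)).
have h2 : mass m4 bad2 <= 2 * beta + 24 * beta.
  apply: (split2); first exact: (ev2 (fun a _ _ => cl a)).
  exact: (ev2 (fun _ b c => ND b c)).
have h3 : mass m4 bad3 <= 2 * beta + (2 * beta + 24 * beta).
  apply: (split2); first exact: (ev3 (fun a _ _ => cl a)).
  apply: (split2); first exact: (ev3 (fun _ b _ => cl b)).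
  exact: (ev3 (fun a b _ => ND a b)).
have h4 : mass m4 bad4 <= 2 * beta + (2 * beta + (2 * beta + (24 * beta + 24 * beta))).
  apply: (split2); first exact: (ev4 (fun a _ _ => cl a)).
  apply: (split2); first exact: (ev4 (fun _ b _ => cl b)).
  apply: (split2); first exact: (ev4 (fun _ _ c => cl c)).
  apply: (split2); first exact: (ev4 (fun a b _ => ND a b)).
  exact: (ev4 (fun _ b c => ND b c)).
have [|[[u1 u2] [u3 u4]] _] :=
    @mass_lt_exists _ _ m4 m4_ge0 setT (bad1 :|: (bad2 :|: (bad3 :|: bad4))).
  rewrite m41; apply: le_lt_trans (split2 _ _ _ _ h1 (split2 _ _ _ _ h2 (split2 _ _ _ _ h3 h4))) _.
  lra.
rewrite !in_setU !negb_or !in_set /= => /and4P[].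
move=> /and3P[c21 N123 N134] /andP[c12 N234] /and3P[c13 c23 N312].
move=> /and5P[c14 c24 c34 N412 N423] _.
have [u1O _ _] := clP _ _ c21.
have [u2O e12 n12] := clP _ _ c12; have [u3O _ n13] := clP _ _ c13.
have [_ e23 n23] := clP _ _ c23; have [_ _ n14] := clP _ _ c14.
have [_ _ n24] := clP _ _ c24; have [_ e34 n34] := clP _ _ c34.
have [d1O u11 u21 E1] := DP _ _ u1O c12; have [d2O u22 u32 E2] := DP _ _ u2O c23.
have [d3O u33 u43 E3] := DP _ _ u3O c34.
rewrite {}E1 in N312 N412; rewrite {}E2 in N123 N423; rewrite {}E3 in N134 N234.
exact: (four_points symE irrE noP7 d1O d2O d3O u11 u21 u22 u32 u33 u43).
Qed.

End LargeNeighbourhood.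

Lemma small_constant (F : realFieldType) :
  exists beta : F, 0 < beta /\ 158 * beta < 1.
Proof.
(* Any positive value below 1/158 would serve. *)
exists (200^-1); split; first by rewrite invr_gt0.
by rewrite ltr_pdivrMr // mul1r ltr_nat.
Qed.

Lemma pmc_large_neighbourhood (F : realFieldType) (T : finType) (E : rel T)
    (Om : {set T}) (mu : T -> F) (beta : F) :
    simple_graph E -> connected_graph E -> Pk_free E 7 -> (1 < #|T|)%nat ->
    potential_maximal_clique E Om ->
    {in Om, forall x, 0 <= mu x} -> \sum_(x in Om) mu x = 1 -> 158 * beta < 1 ->
  exists v, beta <= \sum_(x in Om | E v x) mu x.
Proof.
move=> [symE irrE] connE noP7 T2 pmcO mu_ge0 mu1 beta_small.
(* The values of [mu] outside [Om] are arbitrary, possibly negative, so [mu] is replaced by its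
   extension by zero. *)
pose m x := if x \in Om then mu x else 0.
have massE X : mass m X = \sum_(x in Om | x \in X) mu x.
  by rewrite /mass -big_mkcondr; apply: eq_bigl => x; rewrite andbC.
apply/existsP; apply: contraTT beta_small => /existsPn no_v; rewrite -leNgt.
apply: (large_neighbourhood symE irrE noP7 pmcO (m := m)).
- by move=> x; rewrite /m; case: ifP => // /mu_ge0.
- move=> v; rewrite massE; have := no_v v; rewrite -ltNge => /ltW.
  by under [X in X <= _ -> _]eq_bigl => x do rewrite -[E v x]in_set -/(nbhd E v).
- by rewrite massE -mu1; apply: eq_bigl => x; rewrite inE andbT.
- by move=> x; rewrite /m => /negbTE ->.
move=> x.
(* A second vertex and connectedness give [x] a neighbour, which bounds the weight of the single
   point [x]. *)
have [y yx] : exists y, y != x.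
  apply/existsP; apply: contraLR T2 => /existsPn all_x.
  rewrite -leqNgt -(card1 x); apply/subset_leq_card/subsetP=> y _.
  by have := all_x y; rewrite negbK.
have /connectP[[|z p] /=] := connE x y; first by move=> _ e; rewrite e eqxx in yx.
by case/andP=> xz _ _; exists z; rewrite symE.
Qed.

Local Close Scope ring_scope.

Theorem theorem4 :
  exists beta : R, (0 < beta)%R /\
    forall (T : finType) (E : rel T),
      simple_graph E -> connected_graph E -> Pk_free E 7 -> 2 <= #|T| ->
      forall Om : {set T}, potential_maximal_clique E Om ->
      forall mu : T -> R, prob_on Om mu ->
      exists v : T, (beta <= mu_nbhd E Om mu v)%R.
Proof.
have [beta [beta_gt0 beta_small]] := small_constant (R : realFieldType).
exists beta; split; first exact/RltP.
move=> T E simpleE connE noP7 T2 Om pmcO mu [mu_ge0 mu1].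
have mu_ge0' x : x \in Om -> (GRing.zero <= mu x)%O by move/mu_ge0/RleP.
have [v bv] := pmc_large_neighbourhood simpleE connE noP7 T2 pmcO mu_ge0' mu1 beta_small.
by exists v; apply/RleP.
Qed.
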